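(* Let $r\in[2,\infty)$, let $(X,\|\cdot\|)$ be an $r$-uniformly convex space with constant $c_r$, and let $T:X\to X$ be an operator. For $w\in[0,1)$ consider the condition $$(\mathrm{B}_w)\qquad \|Tx-Ty\|\le\big\|(1-w)x+wTx-\big((1-w)y+wTy\big)\big\|\quad\text{for all }x,y\in X.$$ If $T$ satisfies $(\mathrm{B}_w)$ for some $w\in[0,1)$, then $T$ is $\alpha$-firmly nonexpansive for every $\alpha\in[\frac{1}{1+w},1)$. In particular, if $T$ satisfies $(\mathrm{B}_w)$ for all $w\in[0,1)$ (i.e. $T$ is firmly nonexpansive in the sense of Bruck), then $T$ is $\alpha$-firmly nonexpansive for all $\alpha\in[\frac12,1)$.
   Context: For $r\in[2,\infty)$, a normed space $(X,\|\cdot\|)$ is called $r$-uniformly convex (with constant $c_r$) if there is a constant $c_r>0$ such that for all $w\in[0,1]$ and all $x,y\in X$ $$\|(1-w)x+wy\|^r\le(1-w)\|x\|^r+w\|y\|^r-\frac{c_r}{2}w(1-w)\|x-y\|^r.$$ The constant $c_r$ is fixed. For $\alpha\in(0,1)$, an operator (i.e. a not necessarily linear map) $T:X\to X$ is $\alpha$-firmly nonexpansive if for all $x,y\in X$ $$\|Tx-Ty\|^r\le\|x-y\|^r-\frac{c_r}{2}\,\frac{1-\alpha}{\alpha}\,\|(\mathrm{I}-T)x-(\mathrm{I}-T)y\|^r,$$ where $\mathrm{I}$ is the identity on $X$. *)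

(* Defs.v *)
From HB Require Import structures.
From mathcomp Require Import all_boot all_order all_algebra.
From mathcomp Require Import all_classical all_reals all_analysis.

Set Implicit Arguments.
Unset Strict Implicit.
Unset Printing Implicit Defensive.

Import Order.TTheory GRing.Theory Num.Theory.
Import numFieldNormedType.Exports.

Local Open Scope ring_scope.

Definition uniformly_convex (R : realType) (X : normedModType R) (r c : R) :
    Prop :=
  0 < c /\
  forall (w : R) (x y : X), 0 <= w <= 1 ->
    `|(1 - w) *: x + w *: y| `^ r <=
      (1 - w) * `|x| `^ r + w * `|y| `^ r
      - c / 2 * w * (1 - w) * `|x - y| `^ r.

(* Meant for 0 < alpha < 1. *)
Definition alpha_firmly_nonexpansive (R : realType) (X : normedModType R)
    (r c alpha : R) (T : X -> X) : Prop :=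
  forall x y : X,
    `|T x - T y| `^ r <=
      `|x - y| `^ r
      - c / 2 * ((1 - alpha) / alpha) * `|(x - T x) - (y - T y)| `^ r.

Definition bruck_condition (R : realType) (X : normedModType R) (w : R)
    (T : X -> X) : Prop :=
  forall x y : X,
    `|T x - T y| <=
      `|(1 - w) *: x + w *: T x - ((1 - w) *: y + w *: T y)|.

Definition bruck_firmly_nonexpansive (R : realType) (X : normedModType R)
    (T : X -> X) : Prop :=
  forall w : R, 0 <= w < 1 -> bruck_condition w T.

(* Main.v *)
Require Import Defs.
From HB Require Import structures.
From mathcomp Require Import all_boot all_order all_algebra.
From mathcomp Require Import all_classical all_reals all_analysis.
From mathcomp Require Import ring lra.

Import Order.TTheory GRing.Theory Num.Theory.
Import numFieldNormedType.Exports.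

Local Open Scope ring_scope.

(** Put [u = x - y] and [v = T x - T y].  The condition (B_w) says
    [|v| <= |(1 - w) u + w v|]; raising it to the power [r] and bounding the
    right-hand side by uniform convexity gives
    [|v|^r <= (1 - w) |u|^r + w |v|^r - c/2 w (1 - w) |u - v|^r].  Moving
    [w |v|^r] to the left and dividing by [1 - w > 0] leaves
    [|v|^r <= |u|^r - c/2 w |u - v|^r] ([bruck_condition_powR_le]), which is firm
    nonexpansiveness with the coefficient [w] in place of [(1 - alpha) / alpha].
    Since [|u - v|^r >= 0], the coefficient may be decreased
    ([alpha_firmly_nonexpansive_of_coef]), and [(1 - alpha) / alpha <= w] means
    exactly [alpha >= 1 / (1 + w)].

    If (B_w) holds for all [w < 1], the inequality is affine in [w] and passes to
    the limit [w = 1] ([le_sub_of_le_sub_mul]), which covers the endpoint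
    [alpha = 1/2]. *)

(** The limit [w -> 1] in [b <= a - w d]; a violation at [w = 1] would persist
    for [w] slightly below [1]. *)
Lemma le_sub_of_le_sub_mul (R : realFieldType) (a b d : R) :
  (forall w : R, 0 <= w < 1 -> b <= a - w * d) -> b <= a - d.
Proof.
move=> le_w; rewrite leNgt; apply/negP => lt_b.
have b_le_a : b <= a by have := le_w 0; rewrite lexx ltr01 mul0r subr0 => ->.
have d_gt0 : 0 < d by lra.
(* The midpoint of (a - b) / d, beyond which the hypothesis fails, and 1. *)
pose w := (a - b + d) / (2 * d).
have wd : w * d = (a - b + d) / 2 by rewrite /w; field; rewrite gt_eqF.
have w01 : 0 <= w < 1.
  by rewrite /w divr_ge0 ?ltr_pdivrMr /=; lra.
by have := le_w w w01; rewrite wd; lra.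
Qed.

Lemma bruck_condition_powR_le (R : realType) (X : normedModType R) (r c w : R)
    (T : X -> X) (x y : X) :
  0 <= r -> uniformly_convex X r c -> 0 <= w < 1 -> bruck_condition w T ->
  `|T x - T y| `^ r <=
    `|x - y| `^ r - w * (c / 2 * `|(x - T x) - (y - T y)| `^ r).
Proof.
move=> r_ge0 [_ convX] /andP[w_ge0 w_lt1] /(_ x y) le_T.
have comb : (1 - w) *: x + w *: T x - ((1 - w) *: y + w *: T y) =
    (1 - w) *: (x - y) + w *: (T x - T y).
  by rewrite !scalerBr opprD addrACA.
have diff : (x - y) - (T x - T y) = (x - T x) - (y - T y).
  by rewrite !opprB addrACA [RHS]addrACA [- y - _]addrC.
have w01 : 0 <= w <= 1 by rewrite w_ge0 ltW.
have := convX w (x - y) (T x - T y) w01.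
rewrite diff => le_conv.
have le_pow : `|T x - T y| `^ r <=
    `|(1 - w) *: (x - y) + w *: (T x - T y)| `^ r.
  by apply: ge0_ler_powR; rewrite ?nnegrE ?normr_ge0 // -comb.
have := le_trans le_pow le_conv.
set a := `|x - y| `^ r; set b := `|T x - T y| `^ r; set e := _ `^ r => le_b.
rewrite -(ler_pM2l (_ : 0 < 1 - w)) ?subr_gt0 //.
by lra.
Qed.

Lemma alpha_firmly_nonexpansive_of_coef (R : realType) (X : normedModType R)
    (r c k alpha : R) (T : X -> X) :
  0 <= c -> (1 - alpha) / alpha <= k ->
  (forall x y : X, `|T x - T y| `^ r <=
     `|x - y| `^ r - k * (c / 2 * `|(x - T x) - (y - T y)| `^ r)) ->
  alpha_firmly_nonexpansive r c alpha T.
Proof.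
move=> c_ge0 le_k le_T x y; apply: le_trans (le_T x y) _.
rewrite lerD2l lerN2 mulrAC [leLHS]mulrC ler_wpM2r //.
by rewrite mulr_ge0 ?powR_ge0 // divr_ge0.
Qed.

Lemma coef_le_of_inv_le (R : realFieldType) (w alpha : R) :
  0 <= w -> 1 / (1 + w) <= alpha -> (1 - alpha) / alpha <= w.
Proof.
move=> w_ge0 le_alpha.
have w1_gt0 : 0 < 1 + w by lra.
have alpha_gt0 : 0 < alpha by apply: lt_le_trans le_alpha; rewrite divr_gt0.
by move: le_alpha; rewrite ler_pdivrMr // ler_pdivrMr //; lra.
Qed.

Theorem proposition3p2 (R : realType) (X : normedModType R) (r c : R)
    (T : X -> X) (hr : 2 <= r) (hX : uniformly_convex X r c) :
  (forall w : R, 0 <= w < 1 -> bruck_condition w T ->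
     forall alpha : R, 1 / (1 + w) <= alpha < 1 ->
       alpha_firmly_nonexpansive r c alpha T) /\
  (bruck_firmly_nonexpansive T ->
     forall alpha : R, 1 / 2 <= alpha < 1 ->
       alpha_firmly_nonexpansive r c alpha T).
Proof.
have r_ge0 : 0 <= r by lra.
have c_ge0 : 0 <= c by case: hX => /ltW.
split=> [w w01 Bw alpha /andP[le_alpha _] | B alpha /andP[le_alpha _]].
  apply: (@alpha_firmly_nonexpansive_of_coef _ _ _ _ w) => // [|x y].
    by apply: coef_le_of_inv_le le_alpha; case/andP: w01.
  exact: bruck_condition_powR_le.
apply: (@alpha_firmly_nonexpansive_of_coef _ _ _ _ 1) => // [|x y].
  exact: coef_le_of_inv_le.
rewrite mul1r; apply: le_sub_of_le_sub_mul => w w01.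
by apply: bruck_condition_powR_le => //; exact: B.
Qed.
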